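(* Fix $r\in(0,\infty)$ and let $(s_n)$ be a sequence of integers with $1\le s_n\le n$. For any fixed $l\in[0,\infty)$, let $\hat p_S[l]$ be the Bayes predictive density estimate based on the product spike-and-slab prior $\prod_{i=1}^n\pi_{\mathsf S}[s_n/n,l](d\theta_i)$. Then $$\lim_{n\to\infty}\Bigl\{\max_{\boldsymbol\theta\in\Theta_n[s_n]}\rho(\boldsymbol\theta,\hat p_S[l])\Bigr\}\Big/R_N(\Theta_n[s_n])=\infty.$$
   Context: Model: $\boldsymbol X\sim N_n(\boldsymbol\theta,\boldsymbol I)$ and $\boldsymbol Y\sim N_n(\boldsymbol\theta,r\boldsymbol I)$ are independent given the unknown $\boldsymbol\theta\in\mathbb R^n$; $r>0$ is known and fixed. Let $p(\boldsymbol x|\boldsymbol\theta,1)$ and $p(\boldsymbol y|\boldsymbol\theta,r)$ denote the Gaussian densities of $\boldsymbol X$ and $\boldsymbol Y$. A predictive density estimator $\hat p(\boldsymbol y|\boldsymbol x)$ is, for each $\boldsymbol x\in\mathbb R^n$, a probability density in $\boldsymbol y\in\mathbb R^n$ (jointly measurable). Its Kullback–Leibler loss is $L(\boldsymbol\theta,\hat p(\cdot|\boldsymbol x))=\int p(\boldsymbol y|\boldsymbol\theta,r)\log\frac{p(\boldsymbol y|\boldsymbol\theta,r)}{\hat p(\boldsymbol y|\boldsymbol x)}\,d\boldsymbol y$ and its risk is $\rho(\boldsymbol\theta,\hat p)=\int L(\boldsymbol\theta,\hat p(\cdot|\boldsymbol x))\,p(\boldsymbol x|\boldsymbol\theta,1)\,d\boldsymbol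 x$. For a prior $\pi$ on $\mathbb R^n$ the Bayes predictive density estimate is $\hat p_\pi(\boldsymbol y|\boldsymbol x)=\int p(\boldsymbol y|\boldsymbol\theta,r)\,\pi(d\boldsymbol\theta|\boldsymbol x)$, with $\pi(d\boldsymbol\theta|\boldsymbol x)$ the posterior given $\boldsymbol X=\boldsymbol x$. Let $\|\boldsymbol\theta\|_0=\#\{i:\theta_i\ne0\}$, $\Theta_n[s]=\{\boldsymbol\theta\in\mathbb R^n:\|\boldsymbol\theta\|_0\le s\}$, and $R_N(\Theta)=\inf_{\hat p}\sup_{\boldsymbol\theta\in\Theta}\rho(\boldsymbol\theta,\hat p)$, the infimum being over all predictive density estimators. ''$\max$'' denotes supremum, with values in $[0,\infty]$ (so the ratio may equal $+\infty$). Spike-and-slab prior: $\pi_{\mathsf S}[\eta,l](d\mu)=(1-\eta)\delta_0(d\mu)+\frac{\eta}{2l}\,\mathbf 1\{\mu\in[-l,l]\}\,d\mu$ for $l>0$, where $\delta_0$ is the unit point mass at $0$; for $l=0$ the slab is interpreted as $\delta_0$, so $\pi_{\mathsf S}[\eta,0]=\delta_0$. *)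

(* Defs.v *)
From HB Require Import structures.
From mathcomp Require Import all_boot all_order all_algebra.
From mathcomp Require Import all_classical all_reals all_analysis.
From mathcomp Require Import measurable_realfun.

Set Implicit Arguments.
Unset Strict Implicit.
Unset Printing Implicit Defensive.

Import Order.TTheory GRing.Theory Num.Theory.
Import numFieldNormedType.Exports.

Local Open Scope classical_set_scope.
Local Open Scope ring_scope.

(* R^n with its Borel sigma-algebra, in the form of the library's product
   sigma-algebra on tuples. *)
Notation Rn R n := (n.-tuple (measurableTypeR R)).

Section tuple_product.
Local Open Scope ereal_scope.
Context d (T : measurableType d) (R : realType).

Definition tcons n (p : T * n.-tuple T) : n.+1.-tuple T :=
  [tuple of p.1 :: p.2].

Lemma measurable_tcons n : measurable_fun [set: T * n.-tuple T] (@tcons n).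
Proof. exact: measurable_cons. Qed.

Variable mu : set T -> \bar R.

(* mu x ... x mu (n factors), as a measure on n-tuples *)
Fixpoint tuple_product n : set (n.-tuple T) -> \bar R :=
  match n with
  | 0 => dirac [tuple]
  | n'.+1 => pushforward (mu \x @tuple_product n') (@tcons n')
  end.

End tuple_product.
Arguments tcons {d T n} p.
Arguments tuple_product {d T R} mu n _.

Section tuple_product_sigma_finite.
Local Open Scope ereal_scope.
Context d (T : measurableType d) (R : realType).

Let tuncons n (t : n.+1.-tuple T) : T * n.-tuple T :=
  (tnth t ord0, [tuple of behead t]).

Let tconsK n : cancel (@tcons d T n) (@tuncons n).
Proof. by case=> x t; congr pair; apply/val_inj. Qed.

Let measurable_tuncons n : measurable_fun setT (@tuncons n).
Proof.
by apply/measurable_fun_pair; [exact: measurable_tnth|exact: measurable_behead].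
Qed.

Variable mu : {sigma_finite_measure set T -> \bar R}.

Let tuple_product_packed n :
  exists m : {sigma_finite_measure set (n.-tuple T) -> \bar R},
    tuple_product mu n = m :> (set _ -> \bar R).
Proof.
elim: n => [|n [m mE]].
  by exists (dirac [tuple]).
pose p' : {measure set (n.+1.-tuple T) -> \bar R} :=
  pushforward (mu \x m) (@tcons d T n).
pose p := p' (@measurable_tcons _ T n).
have psf : sigma_finite setT p.
  have /sigma_finiteP[F [FT ndF Foo]] := sigma_finiteT mu.
  have /sigma_finiteP[G [GT ndG Goo]] := sigma_finiteT m.
  exists (fun k => @tuncons n @^-1` (F k `*` G k)).
    rewrite -preimage_bigcup (_ : \bigcup_k _ = setT) ?preimage_setT//.
    apply/seteqP; split=> // -[x t] _ /=.
    have : setT x by []. have : setT t by [].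
    rewrite FT GT => -[i _ Git] [j _ Fjx].
    exists (maxn i j) => //; split=> /=.
      by move: x Fjx; exact/subsetPset/ndF/leq_maxr.
    by move: t Git; exact/subsetPset/ndG/leq_maxl.
  move=> k; have [mF Fk] := Foo k; have [mG Gk] := Goo k; split.
    rewrite -[X in measurable X]setTI; apply: measurable_tuncons => //.
    exact: measurableX.
  rewrite /p /= /pushforward; rewrite (_ : _ @^-1` _ = F k `*` G k).
    by rewrite product_measure1E// lte_mul_pinfty// ge0_fin_numE.
  by apply/funext => x; rewrite -[in RHS](tconsK x).
pose H := @Measure_isSigmaFinite.Build _ _ _ p psf.
exists (HB.pack_for {sigma_finite_measure set (n.+1.-tuple T) -> \bar R}
  (p : set _ -> \bar R) (Measure.class p) H).
by rewrite /= mE.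
Qed.

Let tuple_product0 n : tuple_product mu n set0 = 0.
Proof. by have [m ->] := tuple_product_packed n; rewrite measure0. Qed.

Let tuple_product_ge0 n A : 0 <= tuple_product mu n A.
Proof. by have [m ->] := tuple_product_packed n; exact: measure_ge0. Qed.

Let tuple_product_sigma_additive n : semi_sigma_additive (tuple_product mu n).
Proof.
by have [m ->] := tuple_product_packed n; exact: measure_semi_sigma_additive.
Qed.

HB.instance Definition _ n := isMeasure.Build _ _ _ (tuple_product mu n)
  (tuple_product0 n) (@tuple_product_ge0 n) (@tuple_product_sigma_additive n).

Let tuple_product_sigma_finite n : sigma_finite setT (tuple_product mu n).
Proof. by have [m ->] := tuple_product_packed n; exact: sigma_finiteT. Qed.

HB.instance Definition _ n := Measure_isSigmaFinite.Build _ _ _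
  (tuple_product mu n) (@tuple_product_sigma_finite n).

Lemma tuple_product_box n (A : 'I_n -> set T) :
  (forall i, measurable (A i)) ->
  tuple_product mu n [set t | forall i, A i (tnth t i)] = \prod_(i < n) mu (A i).
Proof.
elim: n A => [|n IH] A mA.
  rewrite big_ord0 /= diracE mem_set//= => i; by have := ltn_ord i.
rewrite big_ord_recl -IH//.
rewrite [LHS]/= /pushforward.
have -> : @tcons d T n @^-1` [set t | forall i, A i (tnth t i)] =
    A ord0 `*` [set t : n.-tuple T | forall i, A (lift ord0 i) (tnth t i)].
  apply/seteqP; split=> -[x t] /=.
    move=> h; split; first exact: (h ord0).
    by move=> i; have := h (lift ord0 i); rewrite tnthS.
  move=> -[h0 h] i; case: (unliftP ord0 i) => [j ->|->]; last exact: h0.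
  by rewrite tnthS.
apply: (@product_measure1E _ _ _ _ _ mu (tuple_product mu n)) => //.
rewrite (_ : [set _ | _] =
    \bigcap_(i in [set: 'I_n]) ((fun t => tnth t i) @^-1` A (lift ord0 i))).
  apply: fin_bigcap_measurable; first exact: finite_finset.
  move=> i _; rewrite -[X in measurable X]setTI.
  exact: measurable_tnth.
by apply/seteqP; split=> t h i; [move=> _; exact: h|exact: h i I].
Qed.

End tuple_product_sigma_finite.

Section tuple_product_probability.
Context d (T : measurableType d) (R : realType).
Variable P : probability T R.

Let tuple_product_setT n : tuple_product P n setT = 1%E.
Proof.
have := @tuple_product_box _ _ _ P n (fun=> setT) (fun=> measurableT).
rewrite big1; last by move=> i _; exact: probability_setT.
by move=> <-; congr tuple_product; apply/seteqP.
Qed.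

HB.instance Definition _ n := Measure_isProbability.Build _ _ _
  (tuple_product P n) (@tuple_product_setT n).

End tuple_product_probability.

Section gaussian.
Context (R : realType) (n : nat).
Implicit Types (v : R) (theta x : Rn R n).

(* density of N_n(theta, v I) at x *)
Definition gauss_pdf v theta x : R :=
  \prod_(i < n) normal_pdf (tnth theta i) (Num.sqrt v) (tnth x i).

Lemma gauss_pdfE v theta x : 0 < v ->
  gauss_pdf v theta x = (Num.sqrt (2 * pi * v) ^+ n)^-1 *
    expR (- (\sum_(i < n) (tnth x i - tnth theta i) ^+ 2) / (2 * v)).
Proof.
move=> v0; have sv0 : Num.sqrt v != 0 by rewrite gt_eqF// sqrtr_gt0.
rewrite -sumrN mulr_suml expR_sum -exprVn -[in X in _ ^+ X](card_ord n).
rewrite -prodr_const -big_split/=; apply: eq_bigr => i _.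
rewrite normal_pdfE// /normal_peak /normal_fun sqr_sqrtr ?ltW//.
by rewrite -mulrA !mulr_natl [pi * v]mulrC.
Qed.

Lemma gauss_pdf_gt0 v theta x : 0 < v -> 0 < gauss_pdf v theta x.
Proof.
move=> v0; rewrite gauss_pdfE// mulr_gt0 ?expR_gt0// invr_gt0 exprn_gt0//.
by rewrite sqrtr_gt0 !mulr_gt0// pi_gt0.
Qed.

Lemma measurable_gauss_pdf v x : 0 < v ->
  measurable_fun [set: Rn R n] (fun theta => gauss_pdf v theta x).
Proof.
move=> v0; under eq_fun do rewrite gauss_pdfE//.
apply: measurable_funM => //; apply: measurableT_comp => //.
apply: measurable_funM => //; apply: measurableT_comp => //.
apply: measurable_sum => i; apply: measurable_funX.
by apply: measurable_funB => //; exact: measurable_tnth.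
Qed.

Lemma gauss_pdf_le v theta x : 0 < v ->
  gauss_pdf v theta x <= (Num.sqrt (2 * pi * v) ^+ n)^-1.
Proof.
move=> v0; rewrite gauss_pdfE// ler_piMr ?invr_ge0 ?exprn_ge0 ?sqrtr_ge0//.
rewrite -expR0 ler_expR mulNr oppr_le0 divr_ge0//.
  by apply: sumr_ge0 => i _; exact: sqr_ge0.
by rewrite mulr_ge0// ltW.
Qed.

End gaussian.

Section bayes.
Context (R : realType) (n : nat).
Local Open Scope ereal_scope.

(* The posterior given X = x of a prior on theta, where X ~ N_n(theta, I),
   in the version given by Bayes' formula. *)
Definition posterior (prior : set (Rn R n) -> \bar R) (x : Rn R n)
    (A : set (Rn R n)) : \bar R :=
  (\int[prior]_(theta in A) (gauss_pdf 1 theta x)%:E) /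
  (\int[prior]_theta (gauss_pdf 1 theta x)%:E).

Section posterior_probability.
Variables (prior : probability (Rn R n) R) (x : Rn R n).

Let lik (theta : Rn R n) : \bar R := (gauss_pdf 1 theta x)%:E.

Let mlik D : measurable_fun D lik.
Proof.
apply: measurable_funTS; apply/measurable_EFinP.
exact: measurable_gauss_pdf.
Qed.

Let lik_ge0 theta : 0 <= lik theta.
Proof. by rewrite lee_fin ltW// gauss_pdf_gt0. Qed.

Let evidence_gt0 : 0 < \int[prior]_theta lik theta.
Proof.
rewrite lt_neqAle integral_ge0// andbT; apply/eqP => /esym e0.
have /(_ e0) : \int[prior]_theta lik theta = 0 -> ae_eq prior setT lik (cst 0).
  move=> h; apply/ae_eq_integral_abs => //.
  by rewrite -[RHS]h; apply: eq_integral => t _; rewrite gee0_abs.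
case=> N [mN N0 sN].
have NT : N = setT.
  apply/seteqP; split=> // t _; apply: sN => /= /(_ I).
  by move/eqP; rewrite /lik eqe gt_eqF// gauss_pdf_gt0.
have := probability_setT prior; rewrite -NT N0 => /esym/eqP.
by rewrite onee_eq0.
Qed.

Let evidence_lty : \int[prior]_theta lik theta < +oo.
Proof.
apply: (@le_lt_trans _ _
    (\int[prior]_theta (cst (Num.sqrt (2 * pi * 1) ^+ n)^-1%:E theta))).
  by apply: ge0_le_integral => // t _; rewrite lee_fin gauss_pdf_le.
by rewrite integral_cst//= probability_setT mule1 ltry.
Qed.

Let evidenceV : exists2 c : {nonneg R},
  c%:num != 0%R & \int[prior]_theta lik theta = c%:num^-1%:E.
Proof.
have := evidence_gt0; have := evidence_lty.
case: (\int[prior]_theta lik theta) => // e _; rewrite lte_fin => e0.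
have c0 : (0 <= e^-1)%R by rewrite invr_ge0 ltW.
by exists (NngNum c0) => /=; rewrite ?invrK// invr_neq0// gt_eqF.
Qed.

Let posterior0 : posterior prior x set0 = 0.
Proof. by rewrite /posterior integral_set0 mul0e. Qed.

Let posterior_ge0 A : 0 <= posterior prior x A.
Proof. by rewrite mule_ge0 ?inve_ge0 ?integral_ge0// => t _; exact: lik_ge0. Qed.

Let posterior_sigma_additive : semi_sigma_additive (posterior prior x).
Proof.
have [c c0 cE] := evidenceV.
have pE A : posterior prior x A = c%:num%:E * \int[prior]_(theta in A) lik theta.
  by rewrite /posterior -/lik cE inver invr_eq0 (negbTE c0) invrK muleC.
move=> F mF tF mUF; rewrite pE.
rewrite [X in X @ _ --> _](_ : _ =
    (fun k => c%:num%:E * \sum_(0 <= i < k) \int[prior]_(theta in F i) lik theta)).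
  apply: cvgeZl => //; rewrite ge0_integral_bigcup//.
  by apply: is_cvg_nneseries => i _ _; exact: integral_ge0.
apply/funext => k; rewrite ge0_sume_distrr//.
  by apply: eq_bigr => i _; rewrite pE.
by move=> i _; exact: integral_ge0.
Qed.

HB.instance Definition _ := isMeasure.Build _ _ _ (posterior prior x)
  posterior0 posterior_ge0 posterior_sigma_additive.

Let posterior_setT : posterior prior x setT = 1.
Proof.
rewrite /posterior divee ?gt_eqF ?evidence_gt0//.
by rewrite ge0_fin_numE ?evidence_lty// ltW ?evidence_gt0.
Qed.

HB.instance Definition _ := Measure_isProbability.Build _ _ _
  (posterior prior x) posterior_setT.

End posterior_probability.

(* fine only turns the (finite) integral into a real: for a probability prior
   the posterior is a probability and gauss_pdf r is bounded. *)
Definition bayes_pred (r : R) (prior : set (Rn R n) -> \bar R)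
    (x y : Rn R n) : R :=
  fine (\int[posterior prior x]_theta (gauss_pdf r theta y)%:E).

End bayes.

Section spike_slab.
Context (R : realType).
Local Open Scope ereal_scope.

(* The uniform law on [-l, l], degenerating to the point mass at 0 when l = 0. *)
Definition slab (l : R) (A : set (measurableTypeR R)) : \bar R :=
  if l == 0%R then \d_(0%R : measurableTypeR R) A
  else \int[lebesgue_measure]_(mu in A) (uniform_pdf (- l) l mu)%:E.

Definition spike_slab (eta l : R) (A : set (measurableTypeR R)) : \bar R :=
  (1 - eta)%:E * \d_(0%R : measurableTypeR R) A + eta%:E * slab l A.

Lemma spike_slab_probability (eta l : R) : (0 <= eta <= 1)%R -> (0 <= l)%R ->
  exists P : probability (measurableTypeR R) R,
    spike_slab eta l = P :> (set _ -> \bar R).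
Proof.
move=> /andP[eta0 eta1] l0.
have [S SE] : exists S : probability (measurableTypeR R) R,
    slab l = S :> (set _ -> \bar R).
  have [->|l_neq0] := eqVneq l 0%R.
    by exists \d_(0%R : measurableTypeR R); apply/funext => A; rewrite /slab eqxx.
  have ll : (- l < l)%R by rewrite gtrN// lt_neqAle eq_sym l_neq0.
  exists (uniform_prob ll); apply/funext => A.
  by rewrite /slab (negbTE l_neq0).
have eta1' : (0 <= 1 - eta)%R by rewrite subr_ge0.
pose m : {measure set (measurableTypeR R) -> \bar R} :=
  measure_add (mscale (NngNum eta1') \d_(0%R : measurableTypeR R))
              (mscale (NngNum eta0) S).
have mA A : m A = (1 - eta)%:E * \d_(0%R : measurableTypeR R) A + eta%:E * S A.
  exact: measure_addE.
have mE : spike_slab eta l = m :> (set _ -> \bar R).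
  by apply/funext => A; rewrite mA /spike_slab SE.
have mT : m setT = 1.
  by rewrite mA diracT probability_setT !mule1 -EFinD subrK.
pose H := Measure_isProbability.Build _ _ _ m mT.
by exists (HB.pack_for (probability (measurableTypeR R) R)
  (m : set _ -> \bar R) (Measure.class m) H).
Qed.

End spike_slab.

Section predictive_risk.
Context (R : realType) (n : nat).
Local Open Scope ereal_scope.

Notation leb := (tuple_product (@lebesgue_measure R) n).

(* x / 0 = +oo for x > 0 and lne +oo = +oo, so the integrand is +oo where q
   vanishes and p does not.  For probability densities its negative part is
   integrable, so the integral is a well-defined element of [0, +oo]. *)
Definition kl_loss (p q : Rn R n -> R) : \bar R :=
  \int[leb]_y ((p y)%:E * lne ((p y)%:E / (q y)%:E)).

Definition pred_density (phat : Rn R n -> Rn R n -> R) : Prop :=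
  [/\ measurable_fun [set: Rn R n * Rn R n] (fun xy => phat xy.1 xy.2),
      forall x y, (0 <= phat x y)%R &
      forall x, \int[leb]_y (phat x y)%:E = 1].

Definition risk (r : R) (theta : Rn R n) (phat : Rn R n -> Rn R n -> R) : \bar R :=
  \int[leb]_x (kl_loss (gauss_pdf r theta) (phat x) * (gauss_pdf 1 theta x)%:E).

Definition max_risk (r : R) (Theta : set (Rn R n))
    (phat : Rn R n -> Rn R n -> R) : \bar R :=
  ereal_sup [set risk r theta phat | theta in Theta].

Definition minimax_risk (r : R) (Theta : set (Rn R n)) : \bar R :=
  ereal_inf [set max_risk r Theta phat | phat in pred_density].

Definition l0norm (theta : Rn R n) : nat := #|[pred i | tnth theta i != 0%R :> R]|.

Definition sparse (s : nat) : set (Rn R n) := [set theta | (l0norm theta <= s)%N].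

End predictive_risk.
Arguments sparse R n s : clear implicits.

(* Main.v *)
(* For every [n >= 1] the ratio is already +oo. The posterior lives on
   [-l, l]^n, so the Bayes predictive density at [y] is at most
   (2 pi r)^(-n/2) exp (- (y_1 - l)_+^2 / (2 r)), whatever [x] is. Against
   theta = (t, 0, ..., 0), which is s-sparse, the Kullback-Leibler loss is then
   at least (t - l)^2 / (4 r) - E|Y - theta|^2 / r, unbounded in [t]. The minimax
   risk lies in [0, +oo): nonnegative by Gibbs' inequality, and finite because
   the plug-in density N(x, r I) has risk bounded uniformly in theta. *)

Require Import Defs.
From mathcomp Require Import all_boot all_order all_algebra.
From mathcomp Require Import all_classical all_reals all_analysis.
From mathcomp Require Import measurable_realfun ring lra.

Import Order.TTheory GRing.Theory Num.Theory.
Import numFieldNormedType.Exports.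

Local Open Scope classical_set_scope.
Local Open Scope ring_scope.

(** * Comparing integrals through pointwise bounds *)

Section integral_facts.
Context d (T : measurableType d) (R : realType).
Variable mu : {measure set T -> \bar R}.
Local Open Scope ereal_scope.

(* With the convention +oo - +oo = -oo, monotonicity needs neither
   integrability nor measurability. *)
Lemma integral_monotone (f g : T -> \bar R) :
  (forall x, f x <= g x) -> \int[mu]_x f x <= \int[mu]_x g x.
Proof.
have nonneg (h k : T -> \bar R) : (forall x, 0 <= h x) ->
    (forall x, h x <= k x) -> \int[mu]_x h x <= \int[mu]_x k x.
  move=> h0 hk; have k0 x : 0 <= k x := le_trans (h0 x) (hk x).
  rewrite !ge0_integralE//; apply: ereal_sup_le => _ [s sh <-].
  exists s => // x; apply: le_trans (sh x) _.
  by rewrite !patchE; case: ifP.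
move=> fg; rewrite integralE [leRHS]integralE; apply: leeB.
- by apply: nonneg => x //; rewrite !funeposE le_max2 ?fg.
- by apply: nonneg => x //; rewrite !funenegE le_max2 ?leeN2 ?fg.
Qed.

(** Every risk estimate below bounds an integrand pointwise by a combination of two probability
    densities; this evaluates the resulting integral. *)
Lemma integral_density_comb (p q : T -> R) (a b : R) :
  measurable_fun setT p -> measurable_fun setT q ->
  (forall y, 0 <= p y)%R -> (forall y, 0 <= q y)%R ->
  \int[mu]_y (p y)%:E = 1 -> \int[mu]_y (q y)%:E = 1 ->
  \int[mu]_y (a * p y + b * q y)%:E = (a + b)%:E.
Proof.
have int (h : T -> R) : measurable_fun setT h -> (forall y, 0 <= h y)%R ->
    \int[mu]_y (h y)%:E = 1 -> mu.-integrable setT (fun y => (h y)%:E).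
  move=> mh h0 h1; apply/integrableP; split; first exact/measurable_EFinP.
  under eq_integral => y _ do rewrite gee0_abs ?lee_fin ?h0//.
  by rewrite h1 ltry.
move=> mp mq p0 q0 p1 q1.
under eq_integral => y _ do rewrite EFinD !EFinM.
rewrite integralD//; [|exact: integrableZl (int _ mp p0 p1)|
  exact: integrableZl (int _ mq q0 q1)].
by rewrite !integralZl ?p1 ?q1 ?mule1//; exact: int.
Qed.

End integral_facts.

(** * Gaussian densities: measurability, total mass, second moment *)

Section gaussian_density.
Context (R : realType).

Notation leb n := (tuple_product (@lebesgue_measure R) n).

Lemma measurable_gauss_pdf_joint n (v : R) : 0 < v ->
  measurable_fun [set: Rn R n * Rn R n] (fun xy => gauss_pdf v xy.1 xy.2).
Proof.
move=> v0; under eq_fun do rewrite gauss_pdfE//.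
apply: measurable_funM => //; apply: measurableT_comp => //.
apply: measurable_funM => //; apply: measurableT_comp => //.
apply: measurable_sum => i; apply: measurable_funX.
by apply: measurable_funB; apply: (measurableT_comp (measurable_tnth i)).
Qed.

Lemma measurable_gauss_pdf_r n (v : R) (theta : Rn R n) : 0 < v ->
  measurable_fun setT (gauss_pdf v theta).
Proof.
move=> v0.
exact: (measurableT_comp (measurable_gauss_pdf_joint n v v0) (pair1_measurable theta)).
Qed.

(** Induction on the dimension: the density factors over the first coordinate and the rest, so
    Tonelli reduces the claim to the one-dimensional normal law. *)
Lemma integral_gauss_pdf n (v : R) (theta : Rn R n) : 0 < v ->
  (\int[leb n]_y (gauss_pdf v theta y)%:E = 1)%E.
Proof.
move=> v0; elim: n theta => [|n IH] theta.
  rewrite /= integral_dirac ?diracT ?mul1e//; first by rewrite /gauss_pdf big_ord0.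
  by apply/measurable_EFinP; exact: measurable_gauss_pdf_r.
have gE (x : R) (t : Rn R n) : gauss_pdf v theta (tcons (x, t)) =
    normal_pdf (tnth theta ord0) (Num.sqrt v) x *
    gauss_pdf v [tuple of behead theta] t.
  rewrite /gauss_pdf big_ord_recl (_ : tnth (tcons (x, t)) ord0 = x)//.
  congr (_ * _); apply: eq_bigr => i _.
  have -> : tnth (tcons (x, t)) (lift ord0 i) = tnth t i by rewrite tnthS.
  have -> : tnth theta (lift ord0 i) = tnth [tuple of behead theta] i.
    by rewrite tnth_behead; congr tnth; apply: val_inj; rewrite [LHS]lift0 [RHS]inordK ?ltnS.
  by [].
have mg := measurable_gauss_pdf_r _ _ theta v0.
have g0 m (t y : Rn R m) : (0 <= (gauss_pdf v t y)%:E)%E.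
  by rewrite lee_fin ltW// gauss_pdf_gt0.
have -> : (\int[leb n.+1]_y (gauss_pdf v theta y)%:E =
    \int[pushforward ((@lebesgue_measure R) \x leb n) (@tcons _ _ n)]_y
      (gauss_pdf v theta y)%:E)%E by [].
rewrite ge0_integral_pushforward//; [|exact: measurable_tcons|exact/measurable_EFinP].
have mgt : measurable_fun setT
    (fun p : R * Rn R n => (gauss_pdf v theta (tcons p))%:E).
  by apply/measurable_EFinP/(measurableT_comp mg); exact: measurable_tcons.
rewrite preimage_setT fubini_tonelli1//; last by move=> ?; exact: g0.
rewrite /fubini_F.
under eq_integral => x _.
  under eq_integral => t _ do rewrite /= gE EFinM.
  rewrite ge0_integralZl//; last 2 first.
    by apply/measurable_EFinP; exact: measurable_gauss_pdf_r.
    by rewrite lee_fin normal_pdf_ge0.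
  rewrite IH mule1.
  over.
exact: integral_normal_pdf.
Qed.

Definition sqdist n (x y : Rn R n) : R :=
  \sum_(i < n) (tnth y i - tnth x i) ^+ 2.

Arguments sqdist {n} x y.

Lemma sqdist_ge0 n (x y : Rn R n) : 0 <= sqdist x y.
Proof. by apply: sumr_ge0 => i _; exact: sqr_ge0. Qed.

(* From [u <= e^u] applied to [u = |y - theta|^2 / (4 v)]: the exponential
   doubles the variance of the Gaussian. *)
Lemma gauss_pdf_sqr_le n (v : R) (theta y : Rn R n) : 0 < v ->
  gauss_pdf v theta y * sqdist theta y <=
  4 * v * Num.sqrt 2 ^+ n * gauss_pdf (2 * v) theta y.
Proof.
move=> v0; set S := sqdist theta y.
rewrite !gauss_pdfE ?mulr_gt0// -/(sqdist theta y) -/S.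
have S_le : S <= 4 * v * expR (S / (4 * v)).
  rewrite mulrC -ler_pdivrMr ?mulr_gt0//.
  by apply: le_trans (expR_ge1Dx _); rewrite lerDr.
have pi0 := pi_gt0 R.
(* The ratio of the normalizing constants for variances [v] and [2 * v] is the source of the factor
   [Num.sqrt 2 ^+ n]. *)
have sE : Num.sqrt 2 ^+ n * (Num.sqrt (2 * pi * (2 * v)) ^+ n)^-1 =
    (Num.sqrt (2 * pi * v) ^+ n)^-1 :> R.
  rewrite (_ : 2 * pi * (2 * v) = 2 * (2 * pi * v)); last by ring.
  by rewrite sqrtrM// exprMn invfM mulVKf// expf_neq0// gt_eqF// sqrtr_gt0.
have eE : expR (- S / (2 * v)) * expR (S / (4 * v)) = expR (- S / (2 * (2 * v))).
  by rewrite -expRD; congr expR; field; rewrite gt_eqF.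
rewrite -eE -sE -!mulrA.
set c := Num.sqrt 2 ^+ n; set k := (_ ^+ n)^-1; set e := expR (- S / _).
have cke0 : 0 <= c * (k * e).
  by rewrite !mulr_ge0 ?expR_ge0// ?invr_ge0 exprn_ge0 ?sqrtr_ge0.
have := ler_wpM2l cke0 S_le; rewrite !mulrA => h; apply: le_trans h _.
by rewrite le_eqVlt; apply/orP; left; apply/eqP; ring.
Qed.

End gaussian_density.
Arguments sqdist {R n} x y.

(** * Gibbs' inequality and bounds on the minimax risk *)

Section kullback_leibler.
Context (R : realType).

Notation leb n := (tuple_product (@lebesgue_measure R) n).

Lemma mule_lne_div (p q : R) : 0 < p -> 0 < q ->
  (p%:E * lne (p%:E / q%:E))%E = (p * ln (p / q))%:E.
Proof.
by move=> p0 q0; rewrite inver gt_eqF// -EFinM lne_EFin ?divr_gt0// EFinM.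
Qed.

(* Where [q] vanishes the integrand is +oo, so only [0 < q] matters. *)
Lemma mule_lne_div_ge (p q c : R) : 0 < p -> 0 <= q ->
  (0 < q -> c <= p * ln (p / q)) -> (c%:E <= p%:E * lne (p%:E / q%:E))%E.
Proof.
move=> p0; rewrite le_eqVlt => /predU1P[<- _|q0 /(_ q0) h].
  by rewrite inver eqxx gt0_muley ?lte_fin//= gt0_muley ?lte_fin// leey.
by rewrite mule_lne_div// lee_fin.
Qed.

(** Gibbs' inequality: [ln u <= u - 1] at [u = q / p] gives [p * ln (p / q) >= p - q] pointwise, and
    [p - q] integrates to 0. *)
Lemma kl_loss_ge0 n (p q : Rn R n -> R) :
  measurable_fun setT p -> measurable_fun setT q ->
  (forall y, 0 < p y) -> (forall y, 0 <= q y) ->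
  (\int[leb n]_y (p y)%:E = 1)%E -> (\int[leb n]_y (q y)%:E = 1)%E ->
  (0 <= kl_loss p q)%E.
Proof.
move=> mp mq p0 q0 p1 q1.
apply: (@le_trans _ _ (\int[leb n]_y (1 * p y + -1 * q y)%:E)%E).
  rewrite integral_density_comb ?subrr// => y; exact/ltW.
apply: integral_monotone => y.
apply: mule_lne_div_ge => // qy0.
have qp0 : 0 < q y / p y by rewrite divr_gt0.
rewrite mul1r mulN1r -[p y / q y]invf_div lnV ?posrE// mulrN.
have /(ler_wpM2l (ltW (p0 y))) : ln (q y / p y) <= q y / p y - 1.
  have := @le_ln1Dx R (q y / p y - 1); rewrite addrCA subrr addr0; apply.
  by rewrite ltrBrDl subrr.
rewrite mulrBr mulr1 mulrCA divff ?gt_eqF// mulr1 => h.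
by rewrite -lerN2 opprK opprB.
Qed.

Lemma risk_ge0 n (r : R) (theta : Rn R n) phat : 0 < r -> pred_density phat ->
  (0 <= risk r theta phat)%E.
Proof.
move=> r0 [mphat phat0 phat1]; apply: integral_ge0 => x _.
apply: mule_ge0; last by rewrite lee_fin ltW// gauss_pdf_gt0.
apply: kl_loss_ge0 => //.
- exact: measurable_gauss_pdf_r.
- exact: (measurableT_comp mphat (pair1_measurable x)).
- by move=> y; exact: gauss_pdf_gt0.
- exact: integral_gauss_pdf.
Qed.

(** A point of [Theta] is asked for because the supremum over the empty set is [-oo]. *)
Lemma minimax_risk_ge0 n (r : R) (Theta : set (Rn R n)) : 0 < r ->
  Theta !=set0 -> (0 <= minimax_risk r Theta)%E.
Proof.
move=> r0 [theta thetaT]; apply: le_ereal_inf_tmp => _ [phat dphat <-].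
apply: (le_trans (risk_ge0 _ _ theta _ r0 dphat)).
by apply: ereal_sup_ubound; exists theta.
Qed.

(** The normalizing constants cancel, leaving [(|y - x|^2 - |y - theta|^2) / (2 r)]; then [|y - x|^2
    <= 2 |y - theta|^2 + 2 |x - theta|^2]. *)
Lemma ln_gauss_pdf_ratio_le n (r : R) (theta x y : Rn R n) : 0 < r ->
  ln (gauss_pdf r theta y / gauss_pdf r x y) <=
  (sqdist theta y + sqdist theta x) / r.
Proof.
move=> r0; rewrite !gauss_pdfE// -!/(sqdist _ _).
have k0 : (Num.sqrt (2 * pi * r) ^+ n)^-1 != 0.
  by rewrite gt_eqF// invr_gt0 exprn_gt0// sqrtr_gt0 !mulr_gt0// pi_gt0.
rewrite -mulf_div divff// mul1r -expRN -expRD expRK.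
rewrite (_ : _ + _ = (sqdist x y - sqdist theta y) / (2 * r)); last first.
  by field; rewrite gt_eqF.
have h : sqdist x y <= 2 * (sqdist theta y + sqdist theta x).
  rewrite /sqdist -big_split/= mulr_sumr; apply: ler_sum => i _.
  (* With [A = y_i - theta_i] and [B = x_i - theta_i], the gap between the two sides,
     [2 A^2 + 2 B^2 - (A - B)^2], is [(A + B)^2]. *)
  have := sqr_ge0 (tnth y i - tnth theta i + (tnth x i - tnth theta i)).
  by rewrite -subr_ge0; set a := tnth y i; set b := tnth x i;
     set c := tnth theta i => /le_trans; apply; nra.
rewrite ler_pdivrMr ?mulr_gt0// [_ * (2 * r)]mulrC mulrA.
rewrite (_ : 2 * r * _ / r = 2 * (sqdist theta y + sqdist theta x)).
  by apply: le_trans h; rewrite gerBl sqdist_ge0.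
by field; rewrite gt_eqF.
Qed.

(** The term [|y - theta|^2 / r] of the log-ratio is absorbed by a multiple of the density of
    variance [2 * r]. The constant is crude, but it depends on [n] alone, and [n] is fixed. *)
Lemma kl_loss_gauss_le n (r : R) (theta x : Rn R n) : 0 < r ->
  (kl_loss (gauss_pdf r theta) (gauss_pdf r x) <=
   (4 * Num.sqrt 2 ^+ n + sqdist theta x / r)%:E)%E.
Proof.
move=> r0; have r20 : 0 < 2 * r by rewrite mulr_gt0.
rewrite -(@integral_density_comb _ _ _ (leb n) (gauss_pdf (2 * r) theta)
  (gauss_pdf r theta)); last 6 first.
- exact: measurable_gauss_pdf_r.
- exact: measurable_gauss_pdf_r.
- by move=> y; rewrite ltW// gauss_pdf_gt0.
- by move=> y; rewrite ltW// gauss_pdf_gt0.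
- exact: integral_gauss_pdf.
- exact: integral_gauss_pdf.
apply: integral_monotone => y.
have p0 := gauss_pdf_gt0 theta y r0.
rewrite mule_lne_div ?gauss_pdf_gt0// lee_fin.
apply: le_trans (ler_wpM2l (ltW p0) (ln_gauss_pdf_ratio_le _ _ theta x y r0)) _.
rewrite mulrDl mulrDr lerD//; last by rewrite mulrC.
rewrite mulrA ler_pdivrMr//; apply: le_trans (gauss_pdf_sqr_le _ _ _ _ _ r0) _.
by rewrite le_eqVlt; apply/orP; left; apply/eqP; ring.
Qed.

(** As a function of [x] and [y], [gauss_pdf r] is the plug-in estimator. Averaging the loss bound
    over [x] uses the same variance doubling, now with variance 1, and yields a bound free of
    [theta]. *)
Lemma risk_gauss_le n (r : R) (theta : Rn R n) : 0 < r ->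
  (risk r theta (gauss_pdf r) <=
   (4 * Num.sqrt 2 ^+ n / r + 4 * Num.sqrt 2 ^+ n)%:E)%E.
Proof.
move=> r0; have lt02 : 0 < 2 :> R by [].
rewrite -(@integral_density_comb _ _ _ (leb n) (gauss_pdf 2 theta)
  (gauss_pdf 1 theta)); last 6 first.
- exact: measurable_gauss_pdf_r.
- exact: measurable_gauss_pdf_r.
- by move=> y; rewrite ltW// gauss_pdf_gt0.
- by move=> y; rewrite ltW// gauss_pdf_gt0.
- exact: integral_gauss_pdf.
- exact: integral_gauss_pdf.
apply: integral_monotone => x.
have p0 := @gauss_pdf_gt0 R n 1 theta x ltr01.
apply: le_trans (lee_wpmul2r _ (kl_loss_gauss_le _ _ theta x r0)) _.
  by rewrite lee_fin ltW.
rewrite -EFinM lee_fin mulrDl addrC lerD//.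
have := gauss_pdf_sqr_le R n 1 theta x ltr01; rewrite !mulr1 => h.
by rewrite mulrAC [leRHS]mulrAC ler_pM2r ?invr_gt0// mulrC.
Qed.

Lemma minimax_risk_lty n (r : R) (Theta : set (Rn R n)) : 0 < r ->
  (minimax_risk r Theta < +oo)%E.
Proof.
move=> r0.
apply: (@le_lt_trans _ _ (max_risk r Theta (gauss_pdf r))).
  apply: ereal_inf_lbound; exists (gauss_pdf r) => //; split.
  - exact: measurable_gauss_pdf_joint.
  - by move=> x y; rewrite ltW// gauss_pdf_gt0.
  - by move=> x; exact: integral_gauss_pdf.
apply: (@le_lt_trans _ _ (4 * Num.sqrt 2 ^+ n / r + 4 * Num.sqrt 2 ^+ n)%:E).
  by apply: ge_ereal_sup => _ [theta _ <-]; exact: risk_gauss_le.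
exact: ltry.
Qed.

End kullback_leibler.

(** * Priors supported in a cube: unbounded risk of the Bayes estimate *)

Section bounded_support.
Context (R : realType).

Notation leb n := (tuple_product (@lebesgue_measure R) n).

Lemma spike_slab_support (eta l : R) : 0 <= l ->
  spike_slab eta l (~` `[- l, l]) = 0%E.
Proof.
move=> l0; have d0 : \d_(0 : measurableTypeR R) (~` `[- l, l]) = 0%E :> \bar R.
  by rewrite diracE memNset//= => /negP; rewrite in_itv/= oppr_le0 l0.
rewrite /spike_slab d0 mule0 add0e /slab; case: ifPn => [_|_].
  by rewrite d0 mule0.
rewrite integral0_eq ?mule0// => u /= /negP; rewrite in_itv/= => ul.
by rewrite /uniform_pdf (negbTE ul).
Qed.

(* The factor of [gauss_pdf] decaying away from [y_i <= l], for a mean whose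
   [i]-th coordinate is at most [l]. *)
Definition tail_bound n (r l : R) (i : 'I_n) (y : Rn R n) : R :=
  (Num.sqrt (2 * pi * r) ^+ n)^-1 *
  expR (- Num.max 0 (tnth y i - l) ^+ 2 / (2 * r)).

Lemma tail_bound_gt0 n (r l : R) (i : 'I_n) y : 0 < r -> 0 < tail_bound n r l i y.
Proof.
move=> r0; rewrite mulr_gt0 ?expR_gt0// invr_gt0 exprn_gt0// sqrtr_gt0.
by rewrite !mulr_gt0// pi_gt0.
Qed.

Lemma gauss_pdf_le_tail_bound n (r l : R) (i : 'I_n) (theta y : Rn R n) :
  0 < r -> tnth theta i <= l -> gauss_pdf r theta y <= tail_bound n r l i y.
Proof.
move=> r0 il; rewrite gauss_pdfE// ler_pM2l; last first.
  by rewrite invr_gt0 exprn_gt0// sqrtr_gt0 !mulr_gt0// pi_gt0.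
rewrite ler_expR ler_pM2r ?invr_gt0 ?mulr_gt0// lerN2.
rewrite (bigD1 i)//= ler_wpDr ?sumr_ge0// => [j _|]; first exact: sqr_ge0.
case: (leP (tnth y i - l) 0) => h; first by rewrite expr0n/= sqr_ge0.
by rewrite lerXn2r ?nnegrE ?lerB// ltW// (lt_le_trans h)// lerB.
Qed.

Lemma bayes_pred_ge0 n (r : R) (prior : probability (Rn R n) R) x y :
  0 < r -> 0 <= bayes_pred r prior x y.
Proof.
move=> r0; apply/fine_ge0/integral_ge0 => t _.
by rewrite lee_fin ltW// gauss_pdf_gt0.
Qed.

(** The posterior has a density with respect to the prior, so it keeps the prior's null sets: almost
    surely [theta_i <= l], and the Bayes density averages Gaussian densities that all lie below
    [tail_bound]. *)
Lemma bayes_pred_le_tail_bound n (r l : R) (P : probability (measurableTypeR R) R)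
    (i : 'I_n) (x y : Rn R n) :
  0 < r -> P (~` `[- l, l]) = 0%E ->
  bayes_pred r (tuple_product P n) x y <= tail_bound n r l i y.
Proof.
move=> r0 Pl; pose prior : probability (Rn R n) R := tuple_product P n.
pose B := [set t : Rn R n | (~` `[- l, l]) (tnth t i)].
have mC : measurable (~` `[- l, l] : set (measurableTypeR R)).
  by apply: measurableC; exact: measurable_itv.
have mB : measurable B.
  rewrite -[B]setTI; exact: measurable_tnth.
have prior0 : prior B = 0%E.
  (* [B] is a box whose only side other than the full line is the [i]-th, which is [P]-null. *)
  pose A j : set (measurableTypeR R) := if j == i then ~` `[- l, l] else setT.
  have mA j : measurable (A j).
    by rewrite /A; case: ifP.
  have -> : B = [set t | forall j, A j (tnth t j)].
    apply/seteqP; split=> t; last by move=> /(_ i); rewrite /A eqxx.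
    by move=> Bt j; rewrite /A; case: eqP => [->|].
  by rewrite [LHS]tuple_product_box// (bigD1 i)//= /A eqxx Pl mul0e.
have post0 : posterior prior x B = 0%E.
  rewrite /posterior null_set_integral ?mul0e//.
  apply: measurable_funTS; apply/measurable_EFinP.
  exact: measurable_gauss_pdf.
have le_int : (\int[posterior prior x]_theta (gauss_pdf r theta y)%:E <=
    (tail_bound n r l i y)%:E)%E.
  apply: (@le_trans _ _ (\int[posterior prior x]_theta
      (cst (tail_bound n r l i y)%:E theta))%E); last first.
    rewrite integral_cst//.
    by rewrite [X in (_ * X)%E](@probability_setT _ _ _ (posterior prior x)) mule1.
  apply: ae_ge0_le_integral => //.
  - by move=> t _; rewrite lee_fin ltW// gauss_pdf_gt0.
  - by apply/measurable_EFinP; exact: measurable_gauss_pdf.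
  - by move=> t _; rewrite lee_fin ltW// tail_bound_gt0.
  exists B; split => // t /=; apply: contra_notP => /contrapT.
  rewrite /mkset in_itv/= => /andP[_ tl] _.
  by rewrite lee_fin; exact: gauss_pdf_le_tail_bound.
have int_ge0 : (0 <= \int[posterior prior x]_theta (gauss_pdf r theta y)%:E)%E.
  by apply: integral_ge0 => t _; rewrite lee_fin ltW// gauss_pdf_gt0.
rewrite -lee_fin /bayes_pred fineK// ge0_fin_numE//.
exact: le_lt_trans le_int (ltry _).
Qed.

(** The log-ratio equals [(M^2 - S) / (2 r)], with [M] the positive part of [y_i - l] and
    [S = |y - theta|^2]. If [theta_i] is far above [l], either [y_i] is too, making [M] large, or
    [y] is far from [theta], making [S] large: [(theta_i - l)^2 <= 2 M^2 + 2 S]. *)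
Lemma ln_gauss_pdf_tail_bound_ge n (r l : R) (i : 'I_n) (theta y : Rn R n) :
  0 < r -> l <= tnth theta i ->
  (tnth theta i - l) ^+ 2 / (4 * r) - sqdist theta y / r <=
  ln (gauss_pdf r theta y / tail_bound n r l i y).
Proof.
move=> r0 li; rewrite /tail_bound gauss_pdfE// -/(sqdist _ _).
set M := Num.max _ _; set S := sqdist _ _; set a := tnth theta i - l.
have k0 : (Num.sqrt (2 * pi * r) ^+ n)^-1 != 0.
  by rewrite gt_eqF// invr_gt0 exprn_gt0// sqrtr_gt0 !mulr_gt0// pi_gt0.
rewrite -[X in ln X]mulf_div divff// mul1r -expRN -expRD expRK.
have M0 : 0 <= M by rewrite le_max lexx.
have My : tnth y i - l <= M by rewrite le_max lexx orbT.
have yS : (tnth y i - tnth theta i) ^+ 2 <= S.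
  rewrite /S /sqdist (bigD1 i)//= ler_wpDr// sumr_ge0// => j _.
  exact: sqr_ge0.
have aM : a ^+ 2 <= 2 * M ^+ 2 + 2 * S.
  have a0 : 0 <= a by rewrite subr_ge0.
  have aMb : a <= M - (tnth y i - tnth theta i) by rewrite /a; lra.
  have : a ^+ 2 <= (M - (tnth y i - tnth theta i)) ^+ 2.
    by rewrite lerXn2r ?nnegrE// (le_trans a0).
  move: yS; set b := tnth y i - _ => yS h; apply: le_trans h _.
  by have := sqr_ge0 (M + b); nra.
rewrite -subr_ge0.
rewrite (_ : _ - _ = (2 * M ^+ 2 + 2 * S - a ^+ 2) / (4 * r)); last first.
  by field; rewrite gt_eqF.
by rewrite divr_ge0 ?subr_ge0// mulr_ge0// ltW.
Qed.

(** The integrand decreases in [q], so [q] may be replaced by [tail_bound]; the loss term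
    [|y - theta|^2 / r] is then controlled by variance doubling. *)
Lemma kl_loss_tail_bound_ge n (r l : R) (i : 'I_n) (theta : Rn R n)
    (q : Rn R n -> R) :
  0 < r -> l <= tnth theta i ->
  (forall y, 0 <= q y <= tail_bound n r l i y) ->
  (((tnth theta i - l) ^+ 2 / (4 * r) - 4 * Num.sqrt 2 ^+ n)%:E <=
   kl_loss (gauss_pdf r theta) q)%E.
Proof.
move=> r0 li q_bound; have r20 : 0 < 2 * r by rewrite mulr_gt0.
rewrite -(@integral_density_comb _ _ _ (leb n) (gauss_pdf r theta)
  (gauss_pdf (2 * r) theta)); last 6 first.
- exact: measurable_gauss_pdf_r.
- exact: measurable_gauss_pdf_r.
- by move=> y; rewrite ltW// gauss_pdf_gt0.
- by move=> y; rewrite ltW// gauss_pdf_gt0.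
- exact: integral_gauss_pdf.
- exact: integral_gauss_pdf.
apply: integral_monotone => y; have /andP[q0 qT] := q_bound y.
have p0 := gauss_pdf_gt0 theta y r0.
apply: mule_lne_div_ge => // qy0.
have T0 := tail_bound_gt0 n r l i y r0.
apply: (@le_trans _ _ (gauss_pdf r theta y *
    ln (gauss_pdf r theta y / tail_bound n r l i y))); last first.
  rewrite ler_pM2l// ler_ln ?posrE ?divr_gt0//.
  by rewrite ler_pM2l// lef_pV2 ?posrE.
apply: le_trans (ler_wpM2l (ltW p0)
  (ln_gauss_pdf_tail_bound_ge _ _ _ i theta y r0 li)).
rewrite mulrBr [X in _ <= X - _]mulrC lerD// mulNr lerN2 mulrA ler_pdivrMr//.
apply: le_trans (gauss_pdf_sqr_le _ _ _ _ _ r0) _.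
by rewrite le_eqVlt; apply/orP; left; apply/eqP; ring.
Qed.

Lemma risk_bayes_pred_ge n (r l : R) (P : probability (measurableTypeR R) R)
    (i : 'I_n) (theta : Rn R n) :
  0 < r -> P (~` `[- l, l]) = 0%E -> l <= tnth theta i ->
  (((tnth theta i - l) ^+ 2 / (4 * r) - 4 * Num.sqrt 2 ^+ n)%:E <=
   risk r theta (bayes_pred r (tuple_product P n)))%E.
Proof.
move=> r0 Pl li; set C := _ - _.
have g0 x : 0 <= gauss_pdf 1 theta x by rewrite ltW// gauss_pdf_gt0.
have mg : measurable_fun setT (gauss_pdf 1 theta).
  exact: measurable_gauss_pdf_r.
have g1 := integral_gauss_pdf R n 1 theta ltr01.
(* The lower bound [C] on the loss does not depend on [x], so it survives averaging over [x]; the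
   summand with coefficient 0 only gives the integral the shape of [integral_density_comb]. *)
apply: (@le_trans _ _
    (\int[leb n]_x (C * gauss_pdf 1 theta x + 0 * gauss_pdf 1 theta x)%:E)%E).
  by rewrite integral_density_comb// addr0.
apply: integral_monotone => x; rewrite mul0r addr0 EFinM.
apply: lee_wpmul2r; first by rewrite lee_fin.
apply: kl_loss_tail_bound_ge => // y.
by rewrite bayes_pred_ge0//= bayes_pred_le_tail_bound.
Qed.

Lemma max_risk_bayes_pred_eqy n s (r l : R)
    (P : probability (measurableTypeR R) R) :
  0 < r -> P (~` `[- l, l]) = 0%E -> (0 < n)%N -> (0 < s)%N ->
  max_risk r (sparse R n s) (bayes_pred r (tuple_product P n)) = +oo%E.
Proof.
move=> r0 Pl n0 s0; pose i := Ordinal n0; apply/eqyP => A A0.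
pose C : R := 4 * Num.sqrt 2 ^+ n.
have C0 : 0 <= C by rewrite mulr_ge0// exprn_ge0// sqrtr_ge0.
(* Since [u >= 1], [u^2 >= u >= 4 r (A + C)], so the risk bound [u^2 / (4 r) - C] is at least
   [A]. *)
pose u := 1 + 4 * r * (A + C).
have u1 : 1 <= u by rewrite lerDl !mulr_ge0 ?addr_ge0// ltW.
pose theta : Rn R n := [tuple if j == i then l + u else 0 | j < n].
have thetai : tnth theta i = l + u by rewrite tnth_mktuple eqxx.
have := risk_bayes_pred_ge n r l P i theta r0 Pl.
rewrite thetai lerDl (le_trans ler01)// => /(_ isT).
rewrite -/C [l + u]addrC addrK => h.
apply: (@le_trans _ _ (u ^+ 2 / (4 * r) - C)%:E).
  rewrite lee_fin lerBrDr ler_pdivlMr ?mulr_gt0// mulrC.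
  have : u <= u ^+ 2 by rewrite expr2 ler_peMr// (le_trans ler01).
  by apply: le_trans; rewrite /u lerDr.
apply: le_trans h _; apply: ereal_sup_ubound; exists theta => //=.
(* The support of [theta] lies in the singleton of [i], and [1 <= s]. *)
rewrite /sparse/= (leq_trans _ s0)// -(card1 i); apply/subset_leq_card.
apply/fintype.subsetP => j; rewrite !inE tnth_mktuple.
by case: (eqVneq j i) => // _; rewrite eqxx.
Qed.

End bounded_support.

(** * The ratio of the two risks *)

Theorem lemma1p1 (R : realType) (r : R) (s : nat -> nat) (l : R)
    (r_gt0 : 0 < r)
    (s_bounds : forall n : nat, (0 < n)%N -> (1 <= s n <= n)%N)
    (l_ge0 : 0 <= l) :
  (fun n : nat =>
     (max_risk r (sparse R n (s n))
        (bayes_pred r (tuple_product (spike_slab ((s n)%:R / n%:R) l) n))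
      / minimax_risk r (sparse R n (s n)))%E) @ \oo --> +oo%E.
Proof.
(* The ratio is constantly [+oo] from [n = 1] on; [s_bounds] says nothing at [n = 0]. *)
apply: cvg_near_cst; exists 1%N => // n /= n0.
have /andP[s1 sn] := s_bounds n n0.
have n0' : 0 < n%:R :> R by rewrite ltr0n.
have [|P PE] := @spike_slab_probability R ((s n)%:R / n%:R) l _ l_ge0.
  by rewrite divr_ge0//= ler_pdivrMr// mul1r ler_nat.
rewrite PE (max_risk_bayes_pred_eqy _ _ _ _ l)//; last first.
  by rewrite -PE; exact: spike_slab_support.
have := minimax_risk_lty R n r (sparse R n (s n)) r_gt0.
have : (0 <= minimax_risk r (sparse R n (s n)))%E.
  apply: minimax_risk_ge0 => //; exists [tuple 0 | _ < n].
  rewrite /sparse/= /l0norm eq_card0// => j.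
  by rewrite !inE tnth_mktuple eqxx.
case: (minimax_risk _ _) => [m| |] //; rewrite lee_fin => m0 _.
(* A zero minimax risk is harmless: its inverse is [+oo] by convention, and [+oo * +oo = +oo]. *)
rewrite inver; case: eqP => [_|/eqP m_neq0]; first by rewrite mulyy.
by rewrite gt0_mulye// lte_fin invr_gt0 lt_neqAle eq_sym m_neq0.
Qed.
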